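(* Let $S_{l_{1},\ldots,l_{k}}$ denote a spider graph with junction vertex $v$, pendant vertices $u_{1},\ldots,u_{k}$, where $k\geq 2$ and for $i=1,\ldots,k$, the length of the path from $v$ to $u_{i}$ is $l_{i}\geq 1$. Then, the number of minimal forts satisfies \[ \lvert\mathcal{F}_{S_{l_{1},\ldots,l_{k}}}\rvert \leq \binom{k}{2}\lvert\mathcal{F}_{P_{n}}\rvert, \] where $n=\sum_{i=1}^{k}l_{i}+1$ is the order of $S_{l_{1},\ldots,l_{k}}$.
   Context: For a graph $G=(V,E)$, a non-empty subset $F\subseteq V$ is a fort if no vertex outside $F$ has exactly one neighbor in $F$; a fort is minimal if every proper subset is not a fort. $\mathcal{F}_{G}$ denotes the collection of all minimal forts of $G$. $P_{n}$ is the path graph on $n$ vertices. A spider graph is a tree with exactly one junction vertex (vertex of degree at least 3). *)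

(* Defs.v *)
From mathcomp Require Import all_boot.

Set Implicit Arguments.
Unset Strict Implicit.
Unset Printing Implicit Defensive.

(* A finite simple graph is a symmetric irreflexive adjacency relation
   [e : rel T] on a finite type [T] of vertices. *)
Definition simple_graph (T : finType) (e : rel T) : Prop :=
  symmetric e /\ irreflexive e.

Definition neighbors (T : finType) (e : rel T) (x : T) : {set T} :=
  [set y | e x y].

Definition degree (T : finType) (e : rel T) (x : T) : nat := #|neighbors e x|.

Definition is_fort (T : finType) (e : rel T) : pred {set T} :=
  fun F => (F != set0) && [forall x in ~: F, #|neighbors e x :&: F| != 1].

Definition minimal_forts (T : finType) (e : rel T) : {set {set T}} :=
  [set F | minset (is_fort e) F].

Definition path_graph (n : nat) : rel 'I_n :=
  fun i j => (i.+1 == j) || (j.+1 == i).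

Definition is_connected (T : finType) (e : rel T) : Prop :=
  forall x y : T, connect e x y.

(* [ucycle] also accepts the empty sequence and, for [e x y], the back-and-forth
   walk [:: x; y]; the cycles of a simple graph are those of size at least 3. *)
Definition acyclic (T : finType) (e : rel T) : Prop :=
  forall c : seq T, 2 < size c -> ~ ucycle e c.

Definition is_tree (T : finType) (e : rel T) : Prop :=
  [/\ simple_graph e, is_connected e & acyclic e].

Definition pendant (T : finType) (e : rel T) : pred T :=
  fun x => degree e x == 1.

Definition junction (T : finType) (e : rel T) : pred T :=
  fun x => 3 <= degree e x.

Definition path_of_length (T : finType) (e : rel T) (x y : T) (m : nat) : Prop :=
  exists p : seq T, [/\ path e x p, uniq (x :: p), last x p = y & size p = m].

(* [e] is the spider S_{l_1,...,l_k} with centre [v] and pendant vertices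
   [u i]. For [k >= 3], [v] is the unique vertex of degree at least 3. For
   [k = 2], where S_{l_1,l_2} is a path with an interior vertex [v], there is
   no vertex of degree at least 3. *)
Definition is_spider (T : finType) (e : rel T) (k : nat) (l : 'I_k -> nat)
    (v : T) (u : 'I_k -> T) : Prop :=
  [/\ is_tree e,
      [set x | junction e x] = (if 3 <= k then [set v] else set0),
      injective u,
      [set x | pendant e x] = [set u i | i : 'I_k] &
      forall i : 'I_k, path_of_length e v (u i) (l i)].

(* Main.v *)
Require Import Defs.
From mathcomp Require Import all_boot zify.

Set Implicit Arguments.
Unset Strict Implicit.
Unset Printing Implicit Defensive.

(** Read along a leg, away from a vertex of the fort, a minimal fort is a binary
    word ending in 1 with no two consecutive 0s and no three consecutive 1s.
    These words of length n are counted by the Padovan recursion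
    p(n+3) = p(n+1) + p(n), and a path on N+1 vertices has at least p(N) minimal
    forts.  A minimal fort of the spider avoiding the centre lives on exactly two
    legs i, j, which leaves at most p(l_i - 1) p(l_j - 1) choices.  A minimal fort
    through the centre contains the neighbour of the centre on at most one leg c;
    on the other legs its words start with 0, so they can be concatenated, which
    leaves at most p(l_c) p(N - l_c - 2) choices, N being the sum of the l_i.
    Both numbers together are at most p(N), and for k > 2 the legs can be assigned
    to distinct pairs of legs containing them; for k = 2 the two families through
    the centre are estimated together. *)

(** * Words *)

(* The letters of [w] are the vertices that follow a vertex of the fort. *)
Fixpoint good (w : bitseq) : bool :=
  match w with
  | [::] | [:: true] => true
  | false :: true :: w' => good w'
  | true :: false :: true :: w' => good w'
  | _ => false
  end.

(** A good word splits into blocks 01 and 101, possibly followed by a single 1. Each block ends in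
    1, so the rest again follows a vertex of the fort and induction on the length applies. The
    [true] put in front of [w] is the vertex that precedes the word. *)
Lemma good_nthP (w : bitseq) :
  good w <->
  [/\ last true w,
      forall m, m < size w -> nth false (true :: w) m || nth false w m
    & forall m, m.+1 < size w ->
        ~~ [&& nth false (true :: w) m, nth false w m & nth false w m.+1]].
Proof.
elim: {w}(size w) {-2}w (leqnn (size w)) => [|n IH] w.
  by case: w => // _; split.
case: w => [|[] [|[] [|[] w]]] //= szw;
  try by split=> [//|[] // h1 h2 h3];
    first [exact: (h2 1 isT) | exact: (h2 2 isT) | exact: (h3 0 isT)].
- by split=> // _; split=> // -[|m].
- have /IH {IH}[IH1 IH2] : size w <= n by lia.
  split=> [/IH1 [h1 h2 h3]|[h1 h2 h3]].
    by split=> // -[|[|[|m]]] //= hm; [exact: h2 m hm | exact: h3 m hm].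
  by apply: IH2; split=> // m hm; [exact: (h2 m.+3 hm)|exact: (h3 m.+3 hm)].
- by split=> // _; split=> // -[|[|m]].
- have /IH {IH}[IH1 IH2] : (size (true :: w)) <= n by rewrite /=; lia.
  split=> [/IH1 [h1 h2 h3]|[h1 h2 h3]].
    by split=> // -[|[|m]] //= hm; [exact: h2 m hm | exact: h3 m hm].
  by apply: IH2; split=> // m hm; [exact: (h2 m.+2 hm)|exact: (h3 m.+2 hm)].
- have /IH {IH}[IH1 IH2] : (size (false :: w)) <= n by rewrite /=; lia.
  split=> [/IH1 [h1 h2 h3]|[h1 h2 h3]].
    by split=> // -[|[|m]] //= hm; [exact: h2 m hm | exact: h3 m hm].
  by apply: IH2; split=> // m hm; [exact: (h2 m.+2 hm)|exact: (h3 m.+2 hm)].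
Qed.

(** Only a final single 1 of [w1] interferes with the blocks of [w2]; since [w2] is empty or starts
    with a block 01, the two merge into a block 101. *)
Lemma good_cat (w1 w2 : bitseq) :
  good w1 -> good w2 -> ~~ head false w2 -> good (w1 ++ w2).
Proof.
move=> + g2 h2; elim: {w1}(size w1) {-2}w1 (leqnn (size w1)) => [|n IH] w1.
  by case: w1.
case: w1 => [|[] [|[] [|[] w]]] //= szw.
- by case: w2 g2 h2 {IH} => [|[] [|[] w2]].
- by move=> gw; apply: IH => //; lia.
- exact: (IH (true :: w) (ltnW szw)).
- exact: (IH (false :: w) (ltnW szw)).
Qed.

Fixpoint words (n : nat) : seq bitseq :=
  match n with
  | 0 => [:: [::]]
  | 1 => [:: [:: true]]
  | 2 => [:: [:: false; true]]
  | (n'.+1 as m).+2 =>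
    map (cat [:: false; true]) (words m) ++
    map (cat [:: true; false; true]) (words n')
  end.

Fixpoint padovan (n : nat) : nat :=
  match n with
  | 0 | 1 | 2 => 1
  | (n'.+1 as m).+2 => padovan m + padovan n'
  end.

Lemma nat_ind3 (P : nat -> Prop) :
  P 0 -> P 1 -> P 2 -> (forall n, P n -> P n.+1 -> P n.+3) -> forall n, P n.
Proof.
move=> P0 P1 P2 PS n; suff: [/\ P n, P n.+1 & P n.+2] by case.
by elim: n => [|n [h0 h1 h2]]; split=> //; apply: PS.
Qed.

Lemma size_words n : size (words n) = padovan n.
Proof.
elim/nat_ind3: n => // n IH0 IH1.
by rewrite [words _]/= size_cat !size_map IH0 -/(words n.+1) IH1.
Qed.

Lemma mem_words n w : (w \in words n) = (size w == n) && good w.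
Proof.
elim/nat_ind3: n w => [||| n IH0 IH1] w.
- by case: w.
- by case: w => [|[] [|[] [|[] w]]].
- by case: w => [|[] [|[] [|[] [|? w]]]].
rewrite -[words _]/(map (cat [:: false; true]) (words n.+1) ++
    map (cat [:: true; false; true]) (words n)) mem_cat.
apply/orP/andP => [[/mapP[w' + ->]|/mapP[w' + ->]]|[/eqP szw gw]].
- by rewrite IH1 => /andP[/eqP<- ?]; rewrite /= eqxx.
- by rewrite IH0 => /andP[/eqP<- ?]; rewrite /= eqxx.
case: w gw szw => [|[] [|[] [|[] w]]] //= gw [szw].
- by right; apply/mapP; exists w => //; rewrite IH0 szw eqxx.
- by left; apply/mapP; exists (true :: w) => //; rewrite IH1 /= szw eqxx.
- by left; apply/mapP; exists (false :: w) => //; rewrite IH1 /= szw eqxx.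
Qed.

Lemma words_uniq n : uniq (words n).
Proof.
elim/nat_ind3: n => // n IH0 IH1.
rewrite [words _]/= cat_uniq !map_inj_uniq ?IH0 -/(words n.+1) ?IH1; try by move=> ? ? [].
rewrite andbT; apply/hasPn => _ /mapP[w _ ->].
by apply/mapP => -[? _].
Qed.

(** For positive [n], the number of words whose first block is 01, the rest being any word of length
    [n - 2]. The empty word is not counted. *)
Definition padovan2 (n : nat) : nat := if n is m.+2 then padovan m else 0.

(** The number of words starting with 1: the single letter 1, or a block 101 followed by any word of
    length [n - 3]. *)
Definition padovan1 (n : nat) : nat :=
  match n with 0 | 2 => 0 | 1 => 1 | m.+3 => padovan m end.

Lemma padovan_mono : {homo padovan : m n / m <= n}.
Proof.
apply: homo_leq; [exact: leqnn | exact: leq_trans |].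
by elim/nat_ind3=> // n h0 h1; apply: leq_add.
Qed.

(* The traces of the minimal forts of a path on both sides of an inner vertex,
   which belongs to the fort in the first two terms and not in the last. *)
Lemma padovan_split a b : padovan (a.+1 + b.+1) =
  padovan a.+1 * padovan2 b.+1 + padovan2 a.+1 * padovan1 b.+1
  + padovan a * padovan b.
Proof.
have split1 c : padovan c.+2 = padovan2 c.+1 + padovan c.
  by case: c => // c; rewrite addnC.
elim/nat_ind3: b => [|||b IH0 IH1].
- by rewrite addn1 split1 /=; lia.
- by rewrite addn2 -[LHS]/(padovan a.+1 + padovan a) /=; lia.
- by rewrite addn3 -[LHS]/(padovan a.+2 + padovan a.+1) split1 /=; lia.
(* All terms that contain [b] obey the Padovan recursion from here on, so both sides do, and the
   three initial values settle the identity. *)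
rewrite !addnS in IH0 IH1 *.
have -> : padovan (a.+1 + b).+4 = padovan (a.+1 + b).+2 + padovan (a.+1 + b).+1 by [].
rewrite IH0 IH1.
have -> : padovan b.+3 = padovan b.+1 + padovan b by [].
have -> : padovan2 b.+4 = padovan2 b.+2 + padovan2 b.+1.
  by case: b {IH0 IH1} => // -[].
have -> : padovan1 b.+4 = padovan1 b.+2 + padovan1 b.+1.
  by case: b {IH0 IH1} => // -[|[]].
lia.
Qed.

Lemma count_words1 n : count (head false) (words n) = padovan1 n.
Proof.
case: n => [|[|[|n]]] //.
rewrite -[words _]/(map (cat [:: false; true]) (words n.+1) ++
    map (cat [:: true; false; true]) (words n)) count_cat !count_map.
rewrite (@eq_count _ _ pred0) // count_pred0 (@eq_count _ _ predT) //.
by rewrite count_predT size_words.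
Qed.

Lemma count_words2 n : 0 < n ->
  count (fun w => ~~ head false w) (words n) = padovan2 n.
Proof.
case: n => [|[|[|n]]] // _.
rewrite -[words _]/(map (cat [:: false; true]) (words n.+1) ++
    map (cat [:: true; false; true]) (words n)) count_cat !count_map.
rewrite (@eq_count _ _ predT) // (@eq_count _ (preim (cat [:: true; false; true]) _) pred0) // count_pred0.
by rewrite addn0 count_predT size_words.
Qed.

(** * Forts of graphs and paths *)

(** [b] records membership in a fort along a path: the hypothesis is the fort condition at an absent
    inner vertex, whose two neighbours are both present or both absent. Two adjacent absent vertices
    therefore force the next one on either side to be absent. *)
Lemma consecutive_gap_spreads (b : nat -> bool) (L : nat) :
  (forall m, m.+2 <= L -> ~~ b m.+1 -> b m = b m.+2) ->
  forall m, m < L -> ~~ b m -> ~~ b m.+1 -> forall j, j <= L -> ~~ b j.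
Proof.
move=> bE m mL bm bm1.
have up d : m + d < L -> ~~ b (m + d) && ~~ b (m + d).+1.
  elim: d => [|d IH] h; first by rewrite addn0 bm.
  have /andP[b0 b1] : ~~ b (m + d) && ~~ b (m + d).+1 by apply: IH; lia.
  rewrite addnS b1 -bE //; lia.
have down d : d <= m -> ~~ b (m - d) && ~~ b (m - d).+1.
  elim: d => [|d IH] h; first by rewrite subn0 bm.
  have /andP[b0 b1] : ~~ b (m - d) && ~~ b (m - d).+1 by apply: IH; lia.
  have E : m - d = (m - d.+1).+1 by lia.
  rewrite E in b0 b1; rewrite b0 bE ?b1 //; lia.
move=> j jL; case: (leqP j m) => [jm|mj].
  by have /andP[] := down (m - j) (leq_subr _ _); rewrite subKn.
have /andP[_] : ~~ b (m + (j.-1 - m)) && ~~ b (m + (j.-1 - m)).+1 by apply: up; lia.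
by have -> : (m + (j.-1 - m)).+1 = j by lia.
Qed.

Lemma card_set1I (T : finType) (a : T) (F : {set T}) :
  #|[set a] :&: F| = (a \in F).
Proof.
case: (boolP (a \in F)) => aF.
  by rewrite (setIidPl _) ?cards1 // sub1set.
by apply/eqP; rewrite cards_eq0 setI_eq0 disjoints1.
Qed.

Lemma card_set2I (T : finType) (a b : T) (F : {set T}) :
  a != b -> #|[set a; b] :&: F| = (a \in F) + (b \in F).
Proof.
move=> ab; rewrite setIUl cardsU !card_set1I.
rewrite -setIIl (_ : [set a] :&: [set b] = set0) ?set0I ?cards0 ?subn0 //.
by apply/eqP; rewrite setI_eq0 disjoints1 inE.
Qed.

Section Forts.

Variables (T : finType) (e : rel T).

Lemma fortP (F : {set T}) :
  reflect (F != set0 /\ forall x, x \notin F -> #|neighbors e x :&: F| != 1)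
          (is_fort e F).
Proof.
apply: (iffP andP) => -[F0 h]; split=> //.
  by move=> x xF; apply: (forall_inP h); rewrite inE.
by apply/forall_inP => x; rewrite inE; apply: h.
Qed.

Lemma fort_nbr1 (F : {set T}) x a :
  is_fort e F -> neighbors e x = [set a] -> x \notin F -> a \notin F.
Proof. by case/fortP=> _ h Nx /h; rewrite Nx card_set1I; case: (_ \in _). Qed.

Lemma fort_nbr2 (F : {set T}) x a b :
  is_fort e F -> neighbors e x = [set a; b] -> a != b -> x \notin F ->
  (a \in F) = (b \in F).
Proof.
by case/fortP=> _ h Nx ab /h; rewrite Nx card_set2I //; do 2!case: (_ \in _).
Qed.

(** All neighbours of [x] are in [F], so no vertex outside [F] notices the removal; [x] itself, now
    outside, sees its whole neighbourhood, whose size is not 1. The neighbour [a] keeps the set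
    non-empty. *)
Lemma fort_remove (F : {set T}) x a :
  simple_graph e -> is_fort e F -> neighbors e x \subset F ->
  #|neighbors e x| != 1 -> a \in neighbors e x -> is_fort e (F :\ x).
Proof.
move=> [esym eirr] /fortP[F0 h] sNF N1 aN; apply/fortP; split.
  apply/set0Pn; exists a; rewrite !inE (subsetP sNF _ aN) andbT.
  by apply: contraTneq aN => ->; rewrite inE eirr.
move=> y; rewrite !inE negb_and negbK => yF.
have [->|yx] := eqVneq y x.
  have -> // : neighbors e x :&: (F :\ x) = neighbors e x.
  apply/setIidPl/subsetP => z zN; rewrite !inE (subsetP sNF _ zN) andbT.
  by apply: contraTneq zN => ->; rewrite inE eirr.
have {}yF : y \notin F by case/orP: yF => [/eqP E|//]; rewrite E eqxx in yx.
have nyx : ~~ e y x.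
  by apply: contra yF => eyx; apply: (subsetP sNF); rewrite inE esym.
suff -> : neighbors e y :&: (F :\ x) = neighbors e y :&: F by apply: h.
apply/setP => z; rewrite !inE; case: eqP => //= ->.
by rewrite (negbTE nyx).
Qed.

Lemma minimal_fort_nbrs (F : {set T}) x a :
  simple_graph e -> minset (is_fort e) F -> x \in F ->
  neighbors e x \subset F -> #|neighbors e x| != 1 -> a \notin neighbors e x.
Proof.
move=> eS /minsetP[Ff Fmin] xF sN N1; apply/negP => aN.
have /Fmin/(_ (subsetDl _ _)) FE := fort_remove eS Ff sN N1 aN.
by move: xF; rewrite -FE !inE eqxx.
Qed.

End Forts.

(** * Minimal forts of a path *)

Section PathForts.

Variable N : nat.
Let b (B : {set 'I_N.+1}) m := inord m \in B.

Lemma path_neighbors0 : 0 < N ->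
  neighbors (@path_graph N.+1) (inord 0) = [set inord 1].
Proof.
by move=> N0; apply/setP => y; rewrite !inE /path_graph -val_eqE /= !inordK //; lia.
Qed.

Lemma path_neighbors_last : 0 < N ->
  neighbors (@path_graph N.+1) (inord N) = [set inord N.-1].
Proof.
move=> N0; apply/setP => y.
by rewrite !inE /path_graph -val_eqE /= !inordK //; have := ltn_ord y; lia.
Qed.

Lemma path_neighbors m : m.+2 <= N ->
  neighbors (@path_graph N.+1) (inord m.+1) = [set inord m; inord m.+2].
Proof.
by move=> mN; apply/setP => y; rewrite !inE /path_graph -!val_eqE /= !inordK //; lia.
Qed.

Lemma path_fort (B : {set 'I_N.+1}) : is_fort (@path_graph N.+1) B ->
  [/\ b B 0, b B N & forall m, m < N -> b B m || b B m.+1].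
Proof.
move=> Bf; have [/set0Pn[z zB] _] := fortP _ _ Bf.
(* A missing end, or two adjacent missing vertices, would empty the whole path. *)
have alive : ~ forall j, j <= N -> ~~ b B j.
  by move=> /(_ z); rewrite /b inord_val zB -ltnS ltn_ord => /(_ isT).
have rule m : m.+2 <= N -> ~~ b B m.+1 -> b B m = b B m.+2.
  move=> mN; apply: fort_nbr2 (path_neighbors mN) _ => //.
  by rewrite -val_eqE /= !inordK //; lia.
have dead := consecutive_gap_spreads rule.
split.
- apply/idPn => b0; apply: alive; case: (posnP N) => [N0 j|N0].
    by rewrite N0 leqn0 => /eqP->.
  by apply: (dead 0) => //; apply: fort_nbr1 (path_neighbors0 N0) b0.
- apply/idPn => bN; apply: alive; case: (posnP N) => [N0 j|N0].
    by rewrite N0 leqn0 => /eqP->; rewrite -N0.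
  apply: (dead N.-1); rewrite ?prednK //.
  by apply: fort_nbr1 (path_neighbors_last N0) bN.
- move=> m mN; apply/idPn; rewrite negb_or => /andP[b0 b1].
  by apply: alive; apply: (dead m).
Qed.

Definition word_set (w : bitseq) : {set 'I_N.+1} :=
  [set i : 'I_N.+1 | nth false (true :: w) i].

(** Vertex 0 belongs to every fort of the path, so the word starts at vertex 1. A smaller fort [B]
    missing a vertex of the set would have to contain both neighbours of that vertex, which gives
    three consecutive 1s in the word. *)
Lemma word_set_minimal w :
  w \in words N -> word_set w \in minimal_forts (@path_graph N.+1).
Proof.
rewrite mem_words => /andP[/eqP szw /good_nthP[lastw gapw densew]].
have wE m : m <= N -> b (word_set w) m = nth false (true :: w) m.
  by move=> mN; rewrite /b inE inordK.
have w0 : b (word_set w) 0 by rewrite wE.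
have wN : b (word_set w) N by rewrite wE // -szw -last_nth.
rewrite inE; apply/minsetP; split.
  apply/fortP; split; first by apply/set0Pn; exists (inord 0).
  move=> x; rewrite -[x]inord_val; have := ltn_ord x.
  case: {x}(nat_of_ord x) => [|m] mN; rewrite -/(b (word_set w) _).
    by rewrite w0.
  move=> xw.
  have mN' : m.+2 <= N.
    by rewrite ltn_neqAle -ltnS mN andbT; apply: contraNneq xw => ->.
  rewrite path_neighbors // card_set2I; last by rewrite -val_eqE /= !inordK //; lia.
  rewrite -!/(b (word_set w) _) !wE ?(ltnW (ltnW mN')) //.
  rewrite wE 1?ltnW //= in xw.
  have := gapw m; have := gapw m.+1; rewrite szw /= (negbTE xw) orbF /=.
  by move=> /(_ mN') -> /(_ (ltnW mN')) ->.
move=> B Bf sBw; have [B0 BN Bgap] := path_fort Bf.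
apply/eqP; rewrite eqEsubset sBw; apply/subsetP => x.
rewrite -[x]inord_val; have := ltn_ord x.
case: {x}(nat_of_ord x) => [|m] mN xw //; rewrite -/(b B _); apply/idPn => xB.
have mN' : m.+2 <= N.
  by rewrite ltn_neqAle -ltnS mN andbT; apply: contraNneq xB => ->.
have := Bgap m; have := Bgap m.+1; rewrite (negbTE xB) orbF /=.
move=> /(_ mN')/(subsetP sBw) w2 /(_ (ltnW mN'))/(subsetP sBw) w1.
have := densew m; rewrite szw => /(_ mN')/negP; apply; apply/and3P.
by rewrite -wE ?(ltnW (ltnW mN')) // -[nth false w m]/(nth false (true :: w) m.+1) -wE 1?ltnW //
  -[nth false w m.+1]/(nth false (true :: w) m.+2) -wE.
Qed.

Lemma path_minimal_forts : padovan N <= #|minimal_forts (@path_graph N.+1)|.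
Proof.
rewrite -size_words -(size_map word_set) cardE; apply: uniq_leq_size.
  rewrite map_inj_in_uniq ?words_uniq // => w1 w2.
  rewrite !mem_words => /andP[/eqP s1 _] /andP[/eqP s2 _] /setP E.
  apply: (@eq_from_nth _ false); rewrite s1 ?s2 // => m mN.
  by have := E (inord m.+1); rewrite !inE inordK.
by move=> _ /mapP[w /word_set_minimal wm ->]; rewrite mem_enum.
Qed.

End PathForts.

(** * Counting the minimal forts of a spider *)

Lemma good_flatten (s : seq bitseq) :
  (forall w, w \in s -> good w && ~~ head false w) ->
  good (flatten s) && ~~ head false (flatten s).
Proof.
elim: s => //= w s IH h.
have /andP[gw hw] := h w (mem_head _ _).
have /andP[gs hs] : good (flatten s) && ~~ head false (flatten s).
  by apply: IH => w' w's; apply: h; rewrite inE w's orbT.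
by rewrite good_cat //=; case: w hw {h gw}.
Qed.

Lemma leq_card_in_seq (X : finType) (Y : eqType) (S : {set X}) (f : X -> Y)
    (L : seq Y) :
  {in S &, injective f} -> {in S, forall x, f x \in L} -> #|S| <= size L.
Proof.
move=> finj fL; rewrite cardE -(size_map f); apply: uniq_leq_size.
  by rewrite map_inj_in_uniq ?enum_uniq // => x y; rewrite !mem_enum; apply: finj.
by move=> _ /mapP[x xS ->]; apply: fL; rewrite -mem_enum.
Qed.

Lemma leq_card_bigcup (X I : finType) (P : {set I}) (S : I -> {set X}) (c : nat) :
  (forall i, i \in P -> #|S i| <= c) -> #|\bigcup_(i in P) S i| <= #|P| * c.
Proof.
move=> h; rewrite -sum_nat_const.
elim/big_ind2: _ => [|A m B n hA hB|i /h //]; first by rewrite cards0.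
by apply: leq_trans (leq_card_setU _ _) _; apply: leq_add.
Qed.

Lemma card_ltn_pairs k : #|[set p : 'I_k * 'I_k | p.1 < p.2]| = 'C(k, 2).
Proof.
rewrite cardsE -sum1_card -(pair_big_dep xpredT (fun i j : 'I_k => i < j) (fun _ _ => 1)) /=.
rewrite (exchange_big_dep xpredT) //= -bin2_sum big_mkord.
apply: eq_bigr => j _.
by rewrite -(big_ord_widen k (fun _ => 1) (ltnW (ltn_ord j))) sum1_card card_ord.
Qed.

(** * Minimal forts in leg coordinates *)

Section SpiderForts.

Variables (T : finType) (e : rel T) (k : nat) (l : 'I_k -> nat) (v : T).
(* [X i m] is the vertex at distance [m] from the centre on the [i]-th leg. *)
Variable X : 'I_k -> nat -> T.

Hypothesis eS : simple_graph e.
Hypothesis l_gt0 : forall i, 0 < l i.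
Hypothesis X0 : forall i, X i 0 = v.
Hypothesis X_inj : forall i j m m', m <= l i -> m' <= l j ->
  X i m = X j m' -> m = m' /\ (m = 0 \/ i = j).
Hypothesis X_surj : forall t, exists i m, m <= l i /\ t = X i m.
Hypothesis nbr_in : forall i m, m.+2 <= l i ->
  neighbors e (X i m.+1) = [set X i m; X i m.+2].
Hypothesis nbr_end : forall i, neighbors e (X i (l i)) = [set X i (l i).-1].
Hypothesis nbr_centre : neighbors e v = [set X i 1 | i : 'I_k].

Lemma X_neq i m m' : m <= l i -> m' <= l i -> m != m' -> X i m != X i m'.
Proof. by move=> h h'; apply: contra_neq => /X_inj -/(_ h h')[]. Qed.

Lemma X_eq i j m m' : m <= l i -> m' <= l j -> 0 < m ->
  (X i m == X j m') = (i == j) && (m == m').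
Proof.
move=> h h' m0; apply/eqP/andP => [/X_inj -/(_ h h')[E]|[/eqP-> /eqP->//]].
by case=> [E0|->]; [rewrite E0 in m0 | rewrite E !eqxx].
Qed.

Lemma fort_leg_dead (F : {set T}) i m : is_fort e F -> m < l i ->
  X i m \notin F -> X i m.+1 \notin F -> forall j, j <= l i -> X i j \notin F.
Proof.
move=> Ff; apply: (@consecutive_gap_spreads (fun m => X i m \in F)) => {}m mi.
by apply: fort_nbr2 (nbr_in mi) _ => //; apply: X_neq; lia.
Qed.

Lemma fort_leg_alive (F : {set T}) i m : is_fort e F -> m <= l i -> X i m \in F ->
  X i (l i) \in F /\ forall j, j < l i -> (X i j \in F) || (X i j.+1 \in F).
Proof.
move=> Ff mi XF; split=> [|j ji]; apply: contraLR XF; last first.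
  by rewrite negb_or => /andP[b0 b1]; apply: (fort_leg_dead Ff ji).
move=> b1; apply: (@fort_leg_dead F i (l i).-1); rewrite ?prednK //.
exact: fort_nbr1 (nbr_end i) b1.
Qed.

(** The middle vertex has degree 2 and both its neighbours in the fort, so it could be removed. *)
Lemma minimal_fort_sparse (F : {set T}) i m : minset (is_fort e) F ->
  m.+2 <= l i -> ~~ [&& X i m \in F, X i m.+1 \in F & X i m.+2 \in F].
Proof.
move=> Fm mi; apply/and3P => -[F0 F1 F2].
have := @minimal_fort_nbrs _ _ _ _ (X i m) eS Fm F1; rewrite nbr_in //.
rewrite subUset !sub1set F0 F2 cards2 X_neq ?inE ?eqxx //; try lia.
Qed.

(** Position [s] is meant to hold a vertex of the fort: the centre for [s = 0], its neighbour for
    [s = 1]. The word reads the vertices beyond it. *)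
Definition leg_word (F : {set T}) (i : 'I_k) (s : nat) : bitseq :=
  mkseq (fun m => X i (s + m).+1 \in F) (l i - s).

Lemma leg_word_words (F : {set T}) i s : minset (is_fort e) F -> s <= l i ->
  X i s \in F -> leg_word F i s \in words (l i - s).
Proof.
move=> Fm si sF; have Ff := minsetp Fm.
have [Fl Fgap] := fort_leg_alive Ff si sF.
rewrite mem_words size_mkseq eqxx; apply/good_nthP.
have wE m : m <= l i - s ->
    nth false (true :: leg_word F i s) m = (X i (s + m) \in F).
  case: m => [|m] mi /=; first by rewrite addn0 sF.
  by rewrite nth_mkseq // addnS.
split=> [|m|m].
- by rewrite (last_nth false) size_mkseq wE // subnKC.
- rewrite size_mkseq => mi; rewrite wE ?(ltnW mi) //.
  rewrite -[nth _ (leg_word F i s) m]/(nth false (true :: leg_word F i s) m.+1) wE //.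
  by rewrite addnS Fgap //; lia.
- rewrite size_mkseq => mi; rewrite wE; last by lia.
  rewrite -[nth _ (leg_word F i s) m]/(nth false (true :: leg_word F i s) m.+1).
  rewrite -[nth _ (leg_word F i s) m.+1]/(nth false (true :: leg_word F i s) m.+2).
  by rewrite !wE ?(ltnW mi) // !addnS; apply: minimal_fort_sparse => //; lia.
Qed.

Lemma leg_word_inj (F F' : {set T}) i s m : leg_word F i s = leg_word F' i s ->
  s < m -> m <= l i -> (X i m \in F) = (X i m \in F').
Proof.
move=> E sm mi; have := congr1 (fun w => nth false w (m - s.+1)) E.
rewrite !nth_mkseq; try lia.
by have -> : (s + (m - s.+1)).+1 = m by lia.
Qed.

Lemma nbr_leg a m y : m < l a -> y \in neighbors e (X a m.+1) ->
  exists2 p, p <= l a & y = X a p /\ (p = m \/ p = m.+2).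
Proof.
case: (ltngtP m.+1 (l a)) => // [h|h] ma.
  rewrite nbr_in // => /set2P[]->; [exists m | exists m.+2] => //; try lia.
    by split=> //; left.
  by split=> //; right.
by rewrite h nbr_end -h => /set1P->; exists m; [lia | split=> //; left].
Qed.

(** Cutting [F] down to two legs without the centre keeps the fort condition: the centre still sees
    two vertices, the other legs see none, and on the two legs the neighbours of an absent vertex
    are unchanged. *)
Lemma two_leg_fort (F : {set T}) i j : is_fort e F -> i != j ->
  X i 1 \in F -> X j 1 \in F ->
  is_fort e (F :&: [set x | [exists a in [set i; j], exists m : 'I_(l a).+1,
                             (0 < m) && (x == X a m)]]).
Proof.
move=> Ff ij Fi Fj; set Q := [set x | _]; have [_ Fx] := fortP _ _ Ff.
have QE a m : m <= l a -> (X a m \in Q) = (0 < m) && (a \in [set i; j]).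
  move=> ma; rewrite inE; apply/exists_inP/andP.
    move=> [c cij /existsP[m' /andP[m'0 /eqP E]]].
    have [mm' []] := X_inj ma (ltn_ord m') E; first by lia.
    by move=> ->; rewrite mm'.
  move=> [m0 aij]; exists a => //; apply/existsP; exists (inord m).
  by rewrite inordK // m0 eqxx.
have Q1 a : (X a 1 \in Q) = (a \in [set i; j]) by rewrite QE.
apply/fortP; split.
  by apply/set0Pn; exists (X i 1); rewrite in_setI Fi Q1 !inE eqxx.
move=> x; have [a [[|m] [ma ->{x}]]] := X_surj x.
  rewrite X0 nbr_centre => _; rewrite neq_ltn; apply/orP; right.
  apply: leq_trans (subset_leq_card (_ : [set X i 1; X j 1] \subset _)).
    by rewrite cards2 X_eq // (negbTE ij).
  by rewrite subUset !sub1set !in_setI Fi Fj !Q1 !inE !eqxx orbT !imset_f.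
rewrite in_setI QE //= => aF.
case: (boolP (a \in [set i; j])) aF => aij; last first.
  move=> _; suff -> : neighbors e (X a m.+1) :&: (F :&: Q) = set0 by rewrite cards0.
  apply/setP => y; rewrite in_setI in_setI in_set0; apply/negP => /and3P[yN _].
  have [p pa [-> _]] := nbr_leg ma yN.
  by rewrite QE // (negbTE aij) andbF.
rewrite andbT => aF.
(* The first vertex of either leg is in [F], so an absent vertex of these legs is not adjacent to
   the discarded centre. *)
have m0 : 0 < m.
  case: m aF {ma} => // aF.
  by move: aij aF; rewrite !inE => /orP[]/eqP->; rewrite ?Fi ?Fj.
have -> : neighbors e (X a m.+1) :&: (F :&: Q) = neighbors e (X a m.+1) :&: F.
  apply/setP => y; rewrite !in_setI; case: (boolP (y \in neighbors e _)) => //= yN.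
  case: (y \in F) => //=.
  have [p pa [-> pm]] := nbr_leg ma yN.
  by rewrite QE // aij andbT; lia.
exact: Fx.
Qed.

Lemma minimal_fort_two_legs (F : {set T}) i j : minset (is_fort e) F -> i != j ->
  X i 1 \in F -> X j 1 \in F ->
  v \notin F /\
  forall a m, m <= l a -> X a m \in F -> (a == i) || (a == j).
Proof.
move=> Fm ij Fi Fj; have [Ff Fmin] := minsetP Fm.
have FE := Fmin _ (two_leg_fort Ff ij Fi Fj) (subsetIl _ _).
have inQ a m : m <= l a -> X a m \in F -> 0 < m /\ ((a == i) || (a == j)).
  move=> ma; rewrite -FE !inE => /andP[_ /exists_inP[c cij]].
  move=> /existsP[m' /andP[m'0 /eqP E]].
  have [mm' []] := X_inj ma (ltn_ord m') E; first by lia.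
  by move=> ->; move: cij; rewrite !inE mm'.
split=> [|a m ma /inQ-/(_ ma)[]//].
by apply/negP; rewrite -(X0 i) => /inQ-/(_ (leq0n _))[].
Qed.

(** A leg met by the fort has no two consecutive gaps, so its first vertex is present; the absent
    centre then needs a second neighbour in the fort. *)
Lemma minimal_fort_off_centre (F : {set T}) : minset (is_fort e) F -> v \notin F ->
  exists i j : 'I_k, [/\ i < j, X i 1 \in F & X j 1 \in F].
Proof.
move=> Fm vF; have Ff := minsetp Fm; have [/set0Pn[x xF] Fx] := fortP _ _ Ff.
have [i [m [mi xE]]] := X_surj x; rewrite xE in xF.
have [_ /(_ 0 (l_gt0 i))] := fort_leg_alive Ff mi xF.
rewrite X0 (negbTE vF) /= => Fi.
have := Fx v vF; rewrite nbr_centre.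
have iN : X i 1 \in [set X i 1 | i : 'I_k] :&: F by rewrite inE imset_f.
rewrite (cardsD1 (X i 1)) iN eqSS cards_eq0 => /set0Pn[y].
rewrite !inE => /and3P[yi /imsetP[j _ yE] yF]; rewrite yE in yi yF.
have ij : i != j by apply: contraNneq yi => ->.
case: (ltngtP i j) => [h|h|/val_inj h].
- by exists i, j.
- by exists j, i.
- by rewrite h eqxx in ij.
Qed.

(** The first vertex of leg [c] may be absent too, so these families share the forts that contain no
    neighbour of the centre. *)
Definition centre_forts (c : 'I_k) : {set {set T}} :=
  [set F in minimal_forts e |
    (v \in F) && [forall i, (i != c) ==> (X i 1 \notin F)]].

Definition pair_forts (i j : 'I_k) : {set {set T}} :=
  [set F in minimal_forts e | [&& v \notin F, X i 1 \in F & X j 1 \in F]].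

Lemma minimal_forts_cover (F : {set T}) : 0 < k -> F \in minimal_forts e ->
  (exists c, F \in centre_forts c) \/ (exists i j : 'I_k, i < j /\ F \in pair_forts i j).
Proof.
move=> k0 Fm; have Fm' : minset (is_fort e) F by rewrite inE in Fm.
case: (boolP (v \in F)) => vF; last first.
  have [i [j [ij Fi Fj]]] := minimal_fort_off_centre Fm' vF.
  by right; exists i, j; rewrite ij inE Fm vF Fi Fj.
left; case: (pickP (fun i => X i 1 \in F)) => [c Fc|F1].
  exists c; rewrite inE Fm vF; apply/forall_inP => i ic.
  by apply/negP => Fi; have [] := minimal_fort_two_legs Fm' ic Fi Fc; rewrite vF.
exists (Ordinal k0); rewrite inE Fm vF.
by apply/forall_inP => i _; rewrite F1.
Qed.

Lemma card_pair_forts i j : i != j ->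
  #|pair_forts i j| <= padovan (l i).-1 * padovan (l j).-1.
Proof.
move=> ij; rewrite -!size_words -(size_allpairs pair).
apply: (@leq_card_in_seq _ _ _ (fun F => (leg_word F i 1, leg_word F j 1))).
  move=> F F'; rewrite !inE => /and4P[Fm vF Fi Fj] /and4P[Fm' vF' Fi' Fj'] [Ei Ej].
  have [_ sF] := minimal_fort_two_legs Fm ij Fi Fj.
  have [_ sF'] := minimal_fort_two_legs Fm' ij Fi' Fj'.
  apply/setP => x; have [a [[|[|m]] [ma ->{x}]]] := X_surj x.
  - by rewrite X0 (negbTE vF) (negbTE vF').
  - by apply/idP/idP => [/(sF _ _ ma)|/(sF' _ _ ma)] /orP[]/eqP->.
  case: (boolP ((a == i) || (a == j))) => [/orP[]/eqP Ea|aij].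
  - by subst a; apply: leg_word_inj Ei _ _.
  - by subst a; apply: leg_word_inj Ej _ _.
  by apply/idP/idP => [/(sF _ _ ma)|/(sF' _ _ ma)]; rewrite (negbTE aij).
move=> F; rewrite !inE => /and4P[Fm vF Fi Fj]; apply/allpairsP.
by exists (leg_word F i 1, leg_word F j 1); rewrite -!subn1 !leg_word_words.
Qed.

Lemma head_leg_word (F : {set T}) i : head false (leg_word F i 0) = (X i 1 \in F).
Proof. by rewrite -nth0 nth_mkseq // subn0. Qed.

(** A fort is encoded by its word on leg [c] and the concatenation of its words on the other legs,
    which all start with 0. The filter [A] serves the case [k = 2], where forts common to both
    families must be counted once. *)
Lemma card_centre_forts (c : 'I_k) (A : pred bitseq) : 1 < k ->
  #|[set F in centre_forts c | A (leg_word F c 0)]| <=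
  count A (words (l c)) * padovan2 (\sum_(i | i != c) l i).
Proof.
move=> k1; have [d dc] : exists d, d != c.
  have : 0 < #|predC1 c| by rewrite cardC1 card_ord; lia.
  by case/card_gt0P => d; exists d.
have R0 : 0 < \sum_(i | i != c) l i by rewrite (bigD1 d) //= ltn_addr.
pose others F := [seq leg_word F i 0 | i <- enum (predC1 c)].
rewrite -count_words2 // -!size_filter -(size_allpairs pair).
apply: (@leq_card_in_seq _ _ _ (fun F => (leg_word F c 0, flatten (others F)))).
  move=> F F'; rewrite !inE => /andP[/and3P[_ vF _] _] /andP[/and3P[_ vF' _] _].
  move=> [Ec Ef]; have /eq_in_map Eo : others F = others F'.
    apply: eq_from_flatten_shape => //.
    by rewrite /shape -!map_comp; apply: eq_map => i /=; rewrite !size_mkseq.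
  apply/setP => x; have [a [[|m] [ma ->{x}]]] := X_surj x; first by rewrite X0 vF vF'.
  apply: (@leg_word_inj _ _ a 0) => //; case: (eqVneq a c) => [->//|ac].
  by apply: Eo; rewrite mem_enum.
move=> F; rewrite !inE => /andP[/and3P[Fm vF /forall_inP F1] AF].
have gF i : leg_word F i 0 \in words (l i).
  by rewrite -[l i]subn0 leg_word_words // X0.
apply/allpairsP; exists (leg_word F c 0, flatten (others F)).
rewrite !mem_filter AF gF /=.
have /andP[go ho] : good (flatten (others F)) && ~~ head false (flatten (others F)).
  apply: good_flatten => _ /mapP[i + ->]; rewrite mem_enum => ic.
  by have := gF i; rewrite mem_words head_leg_word F1 // => /andP[_ ->].
split=> //; rewrite ho mem_words go andbT size_flatten /shape -map_comp /=.
rewrite sumnE big_map big_enum /=.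
by apply/eqP/eq_bigr => i _; rewrite size_mkseq subn0.
Qed.

Lemma card_minimal_forts : 1 < k ->
  #|minimal_forts e| <= 'C(k, 2) * padovan (\sum_i l i).
Proof.
move=> k1; have lS i : l i = (l i).-1.+1 by rewrite prednK.
have sumE c : \sum_i l i = l c + \sum_(i | i != c) l i by rewrite (bigD1 c).
have A_le c : #|centre_forts c| <= padovan (l c) * padovan2 (\sum_(i | i != c) l i).
  rewrite -size_words -count_predT; apply: leq_trans (card_centre_forts c predT k1).
  by apply: subset_leq_card; apply/subsetP => F FA; rewrite inE FA.
have [k3|k2] := ltnP 2 k; last first.
  have {}k2 : k = 2 by lia.
  pose i : 'I_k := Ordinal (ltnW k1); pose j : 'I_k := Ordinal k1.
  have allij a : (a == i) || (a == j).
    by rewrite -!val_eqE /=; have := ltn_ord a; lia.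
  have sumi : \sum_(a | a != i) l a = l j.
    by apply: big_pred1 => a; move: (allij a); rewrite /= -!val_eqE /=; lia.
  have sumj : \sum_(a | a != j) l a = l i.
    by apply: big_pred1 => a; move: (allij a); rewrite /= -!val_eqE /=; lia.
  have -> : 'C(k, 2) = 1 by rewrite k2.
  (* The three families match the three terms of [padovan_split]. A fort through the centre without
     the first vertex of leg [j] is already in the first family. *)
  have cover : minimal_forts e \subset centre_forts i :|:
      [set F in centre_forts j | head false (leg_word F j 0)] :|: pair_forts i j.
    apply/subsetP => F Fm; rewrite !in_setU.
    case: (minimal_forts_cover (ltnW k1) Fm) => [[c Fc]|[a [b [ab Fab]]]]; last first.
      have -> : i = a by apply: val_inj => /=; have := ltn_ord b; lia.
      have -> : j = b by apply: val_inj => /=; have := ltn_ord b; lia.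
      by rewrite Fab orbT.
    have /orP[/eqP<-|/eqP cj] := allij c; first by rewrite Fc.
    rewrite {}cj in Fc; rewrite [X in _ || X || _]inE Fc head_leg_word /=.
    case: (boolP (X j 1 \in F)) => [|Fj]; first by rewrite orbT.
    move: Fc; rewrite !inE => /and3P[-> -> /forall_inP F1] /=.
    apply/orP; left; apply/orP; left; apply/forall_inP => a ai.
    by have := allij a; rewrite (negbTE ai) => /eqP->.
  apply: leq_trans (subset_leq_card cover) _; rewrite mul1n.
  apply: leq_trans (leq_card_setU _ _) _.
  apply: leq_trans (leq_add (leq_card_setU _ _) (leqnn _)) _.
  rewrite (sumE i) sumi (lS i) (lS j) padovan_split -!lS.
  apply: leq_add; last by rewrite card_pair_forts.
  apply: leq_add; first by rewrite -sumi A_le.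
  have := card_centre_forts j (head false) k1.
  by rewrite count_words1 sumj mulnC.
(* As [k > 2], every leg is [c p] for some pair [p]. *)
pose c0 : 'I_k := Ordinal (ltnW k1).
pose c (p : 'I_k * 'I_k) := if (p.1 == 0 :> nat) && (p.2 == k.-1 :> nat) then p.2 else p.1.
pose S p := centre_forts (c p) :|: pair_forts p.1 p.2.
rewrite -card_ltn_pairs.
apply: leq_trans (leq_card_bigcup (S := S) _); last first.
  move=> p; rewrite inE => p12.
  apply: leq_trans (leq_card_setU _ _) _.
  have [d [cd B_le]] : exists d, c p != d /\
      #|pair_forts p.1 p.2| <= padovan (l (c p)).-1 * padovan (l d).-1.
    have p12' : p.1 != p.2 by rewrite -val_eqE neq_ltn p12.
    rewrite /c; case: ifP => _; last by exists p.2; rewrite p12' card_pair_forts.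
    by exists p.1; rewrite eq_sym p12' mulnC card_pair_forts.
  have := A_le (c p); rewrite (sumE (c p)).
  have : l d <= \sum_(i | i != c p) l i by rewrite (bigD1 d) ?leq_addr // eq_sym.
  have := l_gt0 d; rewrite (lS (c p)).
  case: (\sum_(i | _) _) => [|r] ld0 ldr A'; first by lia.
  (* The first term bounds the forts through the centre; the last bounds those of the pair, because
     leg [d] is among the legs of total length [r.+1]. *)
  rewrite padovan_split; apply: leq_add.
    by apply: leq_trans A' (leq_addr _ _).
  apply: leq_trans B_le _; rewrite leq_mul2l; apply/orP; right.
  by apply: padovan_mono; lia.
apply: subset_leq_card; apply/subsetP => F.
case/minimal_forts_cover => [|[a Fa]|[i [j [ij Fij]]]]; first by lia.
  (* The last leg comes from the pair of the first and last legs, any other leg [a] from [a] and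
     [a.+1]; for [k > 2] the latter is never the exceptional pair. *)
  have [p p12 cp] : exists2 p : 'I_k * 'I_k, p.1 < p.2 & c p = a.
    have [ak|ak] := eqVneq (a : nat) k.-1.
      exists (c0, a); first by rewrite /= ak; lia.
      by rewrite /c /= ak !eqxx.
    have a1 : a.+1 < k by have := ltn_ord a; lia.
    exists (a, Ordinal a1); first by rewrite /=.
    by rewrite /c /=; case: ifP => // /andP[]; lia.
  by apply/bigcupP; exists p; [rewrite inE | rewrite in_setU cp Fa].
by apply/bigcupP; exists (i, j); [rewrite inE | rewrite in_setU Fij orbT].
Qed.
End SpiderForts.

(** * Coordinates on a spider *)

Lemma card_legs (T : finType) k (l : 'I_k -> nat) (X : 'I_k -> nat -> T) (v : T) :
  (forall i, X i 0 = v) ->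
  (forall i j m m', m <= l i -> m' <= l j ->
     X i m = X j m' -> m = m' /\ (m = 0 \/ i = j)) ->
  (forall t, exists i m, m <= l i /\ t = X i m) ->
  #|T| = \sum_i l i + 1.
Proof.
move=> X0 X_inj X_surj.
pose g (o : option {i : 'I_k & 'I_(l i)}) :=
  if o is Some t then X (tag t) (tagged t).+1 else v.
have g_inj : injective g.
  have Xv i m : m < l i -> X i m.+1 <> v.
    by move=> mi; rewrite -(X0 i) => /X_inj -/(_ mi (leq0n _))[].
  move=> [[i m]|] [[j m']|] //= E.
  - have [mm' []] // := X_inj _ _ _ _ (ltn_ord m) (ltn_ord m') E.
    move=> ij; subst j; congr (Some (Tagged _ _)).
    by apply: val_inj; case: mm'.
  - by case: (Xv _ _ (ltn_ord m)).
  - by case: (Xv _ _ (ltn_ord m')).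
transitivity #|codom g|.
  apply: eq_card => t; apply/esym/codomP.
  have [i [[|m] [mi ->]]] := X_surj t; first by exists None; rewrite X0.
  by exists (Some (Tagged (fun i => 'I_(l i)) (Ordinal mi))).
rewrite card_codom // card_option card_tagged sumnE big_map big_enum addn1 /=.
by congr _.+1; apply: eq_bigr => i _; rewrite card_ord.
Qed.

Section SpiderCoordinates.

Variables (k : nat) (l : 'I_k -> nat) (T : finType) (e : rel T) (v : T).
Variables (u : 'I_k -> T) (p : 'I_k -> seq T).
Hypothesis l_gt0 : forall i, 0 < l i.
Hypothesis e_sym : symmetric e.
Hypothesis e_irr : irreflexive e.
Hypothesis e_conn : is_connected e.
Hypothesis e_acyclic : acyclic e.
Hypothesis u_inj : injective u.
Hypothesis degree_le2 : forall x, x != v -> degree e x <= 2.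
Hypothesis pendant_u : [set x | pendant e x] = [set u i | i : 'I_k].
Hypothesis p_path : forall i, path e v (p i).
Hypothesis p_uniq : forall i, uniq (v :: p i).
Hypothesis p_last : forall i, last v (p i) = u i.
Hypothesis p_size : forall i, size (p i) = l i.

Definition leg_vertex i m := nth v (v :: p i) m.
Local Notation X := leg_vertex.

Lemma leg_edge i m : m < l i -> e (X i m) (X i m.+1).
Proof. by rewrite -p_size => mi; apply: (pathP v (p_path i)). Qed.

Lemma leg_uniq i m m' : m <= l i -> m' <= l i -> (X i m == X i m') = (m == m').
Proof. by move=> mi m'i; rewrite nth_uniq ?p_uniq //= p_size ltnS. Qed.

Lemma leg_last i : X i (l i) = u i.
Proof. by rewrite -p_last (last_nth v) p_size. Qed.

Lemma leg_neq0 i m : 0 < m -> m <= l i -> X i m != v.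
Proof. by move=> m0 mi; rewrite -[v in _ != v]/(X i 0) leg_uniq // -lt0n. Qed.

(** The path supplies two distinct neighbours, and only the centre may have degree above 2. *)
Lemma leg_nbr_in i m : m.+2 <= l i ->
  neighbors e (X i m.+1) = [set X i m; X i m.+2].
Proof.
move=> mi; apply/esym/eqP; rewrite eqEcard; apply/andP; split.
  rewrite subUset !sub1set !inE e_sym !leg_edge //; lia.
rewrite cards2 leg_uniq; try lia.
rewrite (_ : m != m.+2); last by lia.
by apply: degree_le2; rewrite leg_neq0 //; lia.
Qed.

Lemma leg_nbr_end i : neighbors e (X i (l i)) = [set X i (l i).-1].
Proof.
have /cards1P[x Nx] : pendant e (X i (l i)).
  have : u i \in [set x | pendant e x] by rewrite pendant_u imset_f.
  by rewrite inE leg_last.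
have : X i (l i).-1 \in neighbors e (X i (l i)).
  by rewrite inE e_sym -{2}(prednK (l_gt0 i)) leg_edge // prednK.
by rewrite Nx => /set1P->.
Qed.

Lemma leg_nbr i m y : m < l i -> y \in neighbors e (X i m.+1) ->
  exists2 q, q <= l i & y = X i q /\ (q = m \/ q = m.+2).
Proof. exact: (nbr_leg leg_nbr_in leg_nbr_end). Qed.

(** Strong induction on the smaller position. The predecessor of the common vertex on leg [i] is one
    of its neighbours on leg [j]; induction makes the positions of that neighbour on the two legs
    equal, and [m <= m'] leaves only the predecessor. *)
Lemma leg_position i j m m' : m <= l i -> m' <= l j -> X i m = X j m' -> m = m'.
Proof.
elim/ltn_ind: m i j m' => m IH i j m' mi m'j E.
case: (ltnP m' m) => [h|mm']; first by apply/esym/(IH _ h j i).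
case: m m' mi m'j mm' E IH => [|m] [|m'] //= mi m'j mm' E IH.
  by have := leg_neq0 (ltn0Sn m') m'j; rewrite -E eqxx.
have : X i m \in neighbors e (X j m'.+1) by rewrite inE -E e_sym leg_edge.
case/(leg_nbr m'j) => q qj [Eq mq].
by have := IH m (ltnSn m) i j q (ltnW mi) qj Eq; lia.
Qed.

(** The end of a leg is recognised by its degree, hence independently of the leg on which the vertex
    is read. *)
Lemma leg_endP i m : 0 < m -> m <= l i ->
  (m == l i) = (#|neighbors e (X i m)| == 1).
Proof.
case: m => // m _; rewrite leq_eqVlt; case: (eqVneq m.+1 (l i)) => [->|_] /= mi.
  by rewrite leg_nbr_end cards1 eqxx.
by rewrite leg_nbr_in // cards2 leg_uniq; lia.
Qed.

(** Two legs that meet away from the centre also meet one step further out, and so on up to their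
    common end, where injectivity of [u] applies. *)
Lemma leg_index i j m : 0 < m -> m <= l i -> m <= l j -> X i m = X j m -> i = j.
Proof.
move=> m0 mi; move: {2}(l i - m) (erefl (l i - m)) => d.
elim: d m m0 mi => [|d IH] m m0 mi dE mj E.
  have mE : m = l i by lia.
  have /eqP mE' : m == l j by rewrite leg_endP // -E -leg_endP // mE.
  by apply: u_inj; rewrite -!leg_last -mE -mE'.
have mi' : m < l i by lia.
have mj' : m < l j.
  by rewrite ltn_neqAle mj leg_endP // -E -leg_endP // andbT; lia.
case: m m0 {mi} mj E dE mi' mj' => // m _ mj E dE mi' mj'.
have : X i m.+2 \in neighbors e (X j m.+1) by rewrite inE -E leg_edge.
case/(leg_nbr mj) => q qj [Eq mq].
have mqE : m.+2 = q by apply: leg_position Eq.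
by apply: (IH m.+2) => //; [lia | rewrite {2}mqE].
Qed.

Lemma leg_vertex_inj i j m m' : m <= l i -> m' <= l j ->
  X i m = X j m' -> m = m' /\ (m = 0 \/ i = j).
Proof.
move=> mi m'j E; have mm' := leg_position mi m'j E; split=> //.
case: (posnP m) => [|m0]; [by left | right].
by rewrite -mm' in m'j E; apply: leg_index E.
Qed.

(** * The legs cover the tree *)

Hypothesis k_gt0 : 0 < k.

Definition on_leg x := exists i m, m <= l i /\ x = X i m.

Lemma on_leg_centre : on_leg v.
Proof. by exists (Ordinal k_gt0), 0. Qed.

Lemma on_leg_nbr x y : on_leg x -> x != v -> e x y -> on_leg y.
Proof.
move=> [i [[|m] [mi ->]]]; first by rewrite eqxx.
move=> _ exy; have /(leg_nbr mi)[q qi [-> _]] : y \in neighbors e (X i m.+1).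
  by rewrite inE.
by exists i, q.
Qed.

(* A vertex off the legs would have degree exactly 2, so a walk entering the
   complement of the legs could be prolonged forever without closing a cycle. *)
Lemma off_leg_path w n : e v w -> ~ on_leg w ->
  exists z t, [/\ path e z t, uniq (z :: t), last z t = v, ~ on_leg z & size t = n.+1].
Proof.
move=> evw woff; elim: n => [|n [z [t [zt zu zl zoff zs]]]].
  exists w, [:: v]; rewrite /= e_sym evw; split=> //.
  by rewrite inE !andbT; apply: contraPneq on_leg_centre => <-.
have zv : z != v by apply/eqP => zv; apply: zoff; rewrite zv; apply: on_leg_centre.
case: t => //= z' t in zt zu zl zs *; case/andP: zt => ezz' zt.
(* Pendant vertices are ends of legs, so [z] is not pendant and has a neighbour other than [z']. *)
have [y [yz' ezy]] : exists y, y != z' /\ e z y.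
  have zdeg : #|neighbors e z| != 1.
    apply/negP => z1; apply: zoff.
    have : z \in [set x | pendant e x] by rewrite inE.
    rewrite pendant_u => /imsetP[i _ ->]; exists i, (l i); by rewrite leg_last.
  have z'N : z' \in neighbors e z by rewrite inE.
  rewrite (cardsD1 z') z'N eqSS cards_eq0 in zdeg.
  by case/set0Pn: zdeg => y; rewrite !inE => /andP[]; exists y.
have yt : y \notin z :: z' :: t.
  apply/negP; rewrite !inE (negbTE yz') /= => /orP[/eqP yz|yt].
    by rewrite yz e_irr in ezy.
  (* If [y] lay further along the path, the stretch from [z] to [y] would close to a cycle of length
     at least 3. *)
  case/splitPr: yt zt zu zl zs => t1 t2 zt zu _ _.
  apply: (e_acyclic (c := z :: z' :: rcons t1 y)); first by rewrite /= size_rcons.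
  rewrite /ucycle; move: zt zu; rewrite -cat_rcons cat_path => /andP[zt _] zu.
  have : uniq ((z :: z' :: rcons t1 y) ++ t2) by [].
  rewrite cat_uniq => /andP[-> _]; rewrite andbT /= ezz' /= rcons_path zt last_rcons.
  by rewrite e_sym.
exists y, (z :: z' :: t); split=> //.
- by rewrite /= e_sym ezy ezz' zt.
- by apply/andP.
- move=> yoff; apply: zoff; apply: on_leg_nbr yoff _ _; last by rewrite e_sym.
  by apply: contraNneq yt => ->; rewrite -zl inE mem_last orbT.
- by rewrite /= zs.
Qed.

Lemma centre_nbr w : e v w -> exists i, w = X i 1.
Proof.
move=> evw; have wv : w != v by apply: contraTneq evw => ->; rewrite e_irr.
suff [i [[|m] [mi wE]]] : on_leg w.
- by rewrite wE eqxx in wv.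
- have /(leg_nbr mi)[q qi [vq mq]] : v \in neighbors e (X i m.+1).
    by rewrite inE -wE e_sym.
  have q0 : 0 = q by apply: (@leg_position i i 0 q).
  by exists i; rewrite wE; case: mq => h; rewrite h in q0; rewrite -?q0.
case: (pickP (fun x : {i : 'I_k & 'I_(l i).+1} => w == X (tag x) (tagged x))) => [x|off].
  by move/eqP->; exists (tag x), (tagged x); rewrite -ltnS.
have woff : ~ on_leg w.
  move=> [i [m [mi wE]]].
  by have := off (Tagged (fun i => 'I_(l i).+1) (Ordinal (mi : m < (l i).+1))); rewrite /= wE eqxx.
(* This path would have more distinct vertices than [T] has elements. *)
have [z [t [_ zu _ _ zs]]] := off_leg_path #|T| evw woff.
by have := max_card (mem (z :: t)); rewrite (card_uniqP zu) /= zs => /ltnW; rewrite ltnn.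
Qed.

Lemma leg_surj x : on_leg x.
Proof.
have /connectP[q + ->] := e_conn v x.
elim/last_ind: q => [|q y IH] /=; first by move=> _; apply: on_leg_centre.
rewrite rcons_path last_rcons => /andP[/IH onq eqy].
have [qv|qv] := eqVneq (last v q) v; last exact: on_leg_nbr onq qv eqy.
by rewrite qv in eqy; have [i ->] := centre_nbr eqy; exists i, 1.
Qed.

Lemma leg_nbr_centre : neighbors e v = [set X i 1 | i : 'I_k].
Proof.
apply/setP => w; rewrite inE; apply/idP/imsetP => [/centre_nbr[i ->]|[i _ ->]].
  by exists i.
exact: leg_edge (l_gt0 i).
Qed.

End SpiderCoordinates.

Theorem theorem4p13 (k : nat) (l : 'I_k -> nat)
    (T : finType) (e : rel T) (v : T) (u : 'I_k -> T) :
  2 <= k ->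
  (forall i : 'I_k, 1 <= l i) ->
  is_spider e l v u ->
  let n := (\sum_(i < k) l i + 1)%N in
  #|T| = n /\
  #|minimal_forts e| <= 'C(k, 2) * #|minimal_forts (@path_graph n)|.
Proof.
move=> k2 l_gt0 [[[e_sym e_irr] e_conn e_acyclic] J u_inj Pu legs] /=.
have k_gt0 := ltnW k2.
have deg2 x : x != v -> degree e x <= 2.
  move=> xv; rewrite leqNgt; apply/negP => xJ.
  have : x \in [set x | junction e x] by rewrite inE.
  by rewrite J; case: ifP => _; rewrite inE // (negbTE xv).
have [p pP] := fin_all_exists legs.
have p_path i : path e v (p i) by have [] := pP i.
have p_uniq i : uniq (v :: p i) by have [] := pP i.
have p_last i : last v (p i) = u i by have [] := pP i.
have p_size i : size (p i) = l i by have [] := pP i.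
have X_inj := leg_vertex_inj l_gt0 e_sym u_inj deg2 Pu p_path p_uniq p_last p_size.
have X_surj := leg_surj l_gt0 e_sym e_irr e_conn e_acyclic deg2 Pu
  p_path p_uniq p_last p_size k_gt0.
have X0 i : leg_vertex v p i 0 = v by [].
split; first exact: card_legs X0 X_inj X_surj.
rewrite addn1; apply: leq_trans (leq_mul (leqnn _) (path_minimal_forts _)).
apply: (card_minimal_forts _ l_gt0 X0 X_inj X_surj) => //.
- exact: (leg_nbr_in e_sym deg2 p_path p_uniq p_size).
- exact: (leg_nbr_end l_gt0 e_sym Pu p_path p_last p_size).
- exact: (leg_nbr_centre l_gt0 e_sym e_irr e_acyclic deg2 Pu p_path p_uniq p_last p_size).
Qed.
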